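(* Let $V$ be a complex vector space of dimension $3$ and let $\sigma:\mathbb{P}_2=\mathbb{P}(V)\dashrightarrow\mathbb{P}_3=\mathbb{P}(W)$ be a normal plane quadratic congruence such that $L(\sigma)=H(\sigma)$. Then there exist a rational map $R:\mathbb{P}(V)\dashrightarrow PGL(V)$ defined by quadratic forms (i.e. given by a $3\times3$ matrix whose entries are homogeneous polynomials of degree $2$ on $V$) and a conic $C_0$ of $\mathbb{P}(V)$ such that for a general point $P$ of $\mathbb{P}(V)$ one has $\sigma(P)=R(P)^{-1}(C_0)$.
   Context: Let $W\subset S^2V^*$ be a linear subspace of dimension $4$; points of $\mathbb{P}(W)$ are viewed as conics of $\mathbb{P}(V)$. A (plane) quadratic congruence with values in $\mathbb{P}(W)$ is a rational map $\sigma:\mathbb{P}(V)\dashrightarrow\mathbb{P}(W)$ such that: (1) $\sigma^*(\mathcal{O}(1))=\mathcal{O}(2)$; (2) $\sigma^*:W^*\to H^0(\mathbb{P}(V),\mathcal{O}(2))=S^2V^*$ induces an isomorphism $W^*\simeq W$; (3) $P\in\sigma(P)$ for every point $P$ where $\sigma$ is defined. The isomorphism $\phi=(\sigma^* )^{-1}:W\to W^*$ is assumed not antisymmetric. The congruence is normal if $W$ is the space of equations of all conics containing a quadric $C$ of a line $H$ of $\mathbb{P}(V)$ (two distinct points, or a double point of $H$); one writes $H(\sigma)=H$. For a normal congruence, the restriction of $\sigma$ to the line $H(\sigma)$ is constant, and its value is a degenerate conic, union of $H(\sigma)$ and another line $L(\sigma)$ (with $L(\sigma)=H(\sigma)$ if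 that conic is a double line). *)

(* Defs.v *)
From HB Require Import structures.
From mathcomp Require Import all_boot all_order all_algebra.
From mathcomp Require Export reals complex mpoly.

Set Implicit Arguments.
Unset Strict Implicit.
Unset Printing Implicit Defensive.

Import GRing.Theory.
Local Open Scope ring_scope.

(* A homogeneous polynomial map V -> T of degree 2 is x |-> b x x for a
   bilinear map b, unique if required to be symmetric (characteristic 0).
   Thus S^2 V^* is the space of symmetric elements of Bil(V, K^o). *)
Notation "'Bil' ( V , T )" := 'Hom(V, 'Hom(V, T)) (only parsing).

Section QuadraticCongruences.
Variable K : fieldType.
Implicit Types U V T : vectType K.

Definition symmetric_bil V T (b : Bil(V, T)) : Prop :=
  forall x y, b x y = b y x.

(* The equation of a conic of P(V) (or of a quadric of a line, if dim V = 2);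
   the conic itself is the corresponding point of P(S^2 V^* ), so it keeps
   its multiplicities. *)
Definition quadric_equation V (q : Bil(V, K^o)) : Prop :=
  q != 0 /\ symmetric_bil q.

Definition same_quadric V (q q' : Bil(V, K^o)) : Prop :=
  (<[q]> = <[q']>)%VS.

Definition pullback U V (g : 'Hom(U, V)) (q : Bil(V, K^o)) : Bil(U, K^o) :=
  linfun (fun x : U => (q (g x) \o g)%VF).

Definition restrict V (H : {vspace V}) (q : Bil(V, K^o)) :
    Bil(subvs_of H, K^o) :=
  pullback (linfun vsval) q.

Section Congruence.
Variables (V : vectType K) (W : {vspace Bil(V, K^o)}).

(* A rational map sigma : P(V) --> P(W) with sigma^* O(1) = O(2) is given by a
   quadratic map V -> W, x |-> s x x, whose components have no common linear
   factor; s is unique up to a nonzero scalar.  In particular s is nonzero,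
   and sigma is defined at the point [x] iff s x x != 0. *)
Definition no_common_factor (s : Bil(V, subvs_of W)) : Prop :=
  ~ exists (h : 'Hom(V, K^o)) (t : 'Hom(V, subvs_of W)),
      h != 0 /\ forall x, s x x = h x *: t x.

Definition sigma_star (s : Bil(V, subvs_of W)) :
    'Hom('Hom(subvs_of W, K^o), Bil(V, K^o)) :=
  linfun (fun l => linfun (fun x : V => (l \o s x)%VF)).

Definition phi (s : Bil(V, subvs_of W)) (w : subvs_of W) :
    'Hom(subvs_of W, K^o) :=
  ((sigma_star s)^-1)%VF (vsval w).

Record quadratic_congruence (s : Bil(V, subvs_of W)) : Prop :=
  QuadraticCongruence {
    congr_symW : forall q, q \in W -> symmetric_bil q;
    congr_dimW : \dim W = 4%N;
    congr_sym : symmetric_bil s;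
    congr_degree : no_common_factor s;
    congr_inj : lker (sigma_star s) = 0%VS;
    congr_img : limg (sigma_star s) = W;
    congr_incident : forall x, s x x != 0 -> vsval (s x x) x x = 0;
    congr_not_antisym : ~ forall w w', phi s w w' = - phi s w' w
  }.

(* W is the space of equations of the conics containing the quadric C = {c = 0}
   of the line P(H); containment is scheme-theoretic, so that it makes sense
   for a double point C, and includes the conics which contain P(H). *)
Definition normal_congruence (H : {vspace V}) : Prop :=
  \dim H = 2%N /\
  exists c : Bil(subvs_of H, K^o), quadric_equation c /\
    forall q, q \in W <-> symmetric_bil q /\ restrict H q \in <[c]>%VS.

Definition line_pair (q : Bil(V, K^o)) (H L : {vspace V}) : Prop :=
  exists h l : 'Hom(V, K^o),
    [/\ lker h = H, lker l = L & forall x, q x x = h x * l x].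

(* P(L) is the line L(sigma), where P(H) is H(sigma). *)
Definition is_Lsigma (s : Bil(V, subvs_of W)) (H L : {vspace V}) : Prop :=
  \dim L = 2%N /\
  exists q, [/\ quadric_equation q, line_pair q H L
    & forall x, x \in H -> s x x != 0 -> same_quadric (vsval (s x x)) q].

End Congruence.

(* P [x] holds on a nonempty Zariski open subset of P(V). *)
Definition general_point V (P : V -> Prop) : Prop :=
  exists (d : nat) (p : {mpoly K[\dim {:V}]}),
    [/\ p \is d.-homog, p != 0
      & forall x : V, x != 0 ->
          p.@[fun i => coord (vbasis {:V}) i x] != 0 -> P x].

(* The functions passed to linfun above are linear, so that pullback and
   sigma_star have the intended values. *)
Lemma pullbackE U V (g : 'Hom(U, V)) (q : Bil(V, K^o)) x y :
  pullback g q x y = q (g x) (g y).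
Proof.
have lin : linear (fun x : U => (q (g x) \o g)%VF).
  move=> a u v; apply/lfunP=> z.
  by rewrite !(linearP, add_lfunE, scale_lfunE, comp_lfunE).
pose F := GRing.isLinear.Build _ _ _ _ _ lin.
pose f : {linear U -> 'Hom(U, K^o)} := HB.pack (fun x : U => (q (g x) \o g)%VF) F.
by rewrite /pullback (lfunE f) /= lfunE.
Qed.

Lemma sigma_starE V (W : {vspace Bil(V, K^o)}) (s : Bil(V, subvs_of W)) l x y :
  sigma_star s l x y = l (s x y).
Proof.
have lin1 m : linear (fun x : V => (m \o s x)%VF : 'Hom(V, K^o)).
  move=> a u v; apply/lfunP=> z.
  by rewrite !(linearP, add_lfunE, scale_lfunE, comp_lfunE).
pose f1 m : {linear V -> 'Hom(V, K^o)} :=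
  HB.pack (fun x : V => (m \o s x)%VF : 'Hom(V, K^o))
    (GRing.isLinear.Build _ _ _ _ _ (lin1 m)).
have E1 m u v : linfun (f1 m) u v = m (s u v) by rewrite lfunE /= lfunE.
have lin2 : linear (fun m => linfun (f1 m)).
  move=> a m n; apply/lfunP=> u; apply/lfunP=> v.
  by rewrite !(E1, add_lfunE, scale_lfunE).
pose f2 : {linear 'Hom(subvs_of W, K^o) -> Bil(V, K^o)} :=
  HB.pack (fun m => linfun (f1 m))
    (GRing.isLinear.Build _ _ _ _ _ lin2).
by rewrite -[sigma_star s]/(linfun f2) lfunE /= E1.
Qed.

End QuadraticCongruences.

(* Main.v *)
(* Choose a basis of V whose first two vectors lie on H, with dual coordinates
   x, y, z; then H is z = 0, and W is spanned by xz, yz, z^2 and either xy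
   (C is two points) or x^2 (C is a double point).  At u = (p, q, r), the
   identity sigma(u)(u) = 0 and the condition L(sigma) = H determine most
   coefficients of the equation of sigma(u).
   - Two points: up to a factor, it is XY - l1 l2 z^2, where
     X = f r x + m2 z, Y = f r y + m1 z, f is a nonzero constant and m1, m2, l1,
     l2 are linear forms in u.  Multiplying by l1 l2 gives
     (l1 X)(l2 Y) - (l1 l2 z)^2, so that R = (l1 X, l2 Y, l1 l2 z) works; if
     l1 l2 = 0, one takes R = (r X, r Y, r^2 z) and C0 : XY = 0.
   - Double point: it is f r^2 x^2 + zT, where T is linear in x, y, z and
     quadratic in u.  Multiplying by r^2 gives f (r^2 x)^2 + (r^2 z) T, so that
     R = (r^2 x, T, r^2 z) works. *)
From HB Require Import structures.
Require Import Defs.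
From mathcomp Require Import all_boot all_order all_algebra.
From mathcomp Require Import ring.
Import GRing.Theory Num.Theory.
Local Open Scope ring_scope.
Set Implicit Arguments.
Unset Strict Implicit.
Unset Printing Implicit Defensive.

(** * Multilinear functions as elements of [Hom] spaces *)

Section Multilinear.
Variable K : fieldType.

Lemma linear_lfun (U T : vectType K) (F : U -> T) :
  linear F -> exists f : 'Hom(U, T), forall u, f u = F u.
Proof.
move=> linF.
pose f : {linear U -> T} := HB.pack F (GRing.isLinear.Build _ _ _ _ _ linF).
by exists (linfun f) => u; rewrite lfunE.
Qed.

Lemma bilinear_lfun (U U' T : vectType K) (F : U -> U' -> T) :
  (forall u, linear (F u)) -> (forall u', linear (F^~ u')) ->
  exists b : 'Hom(U, 'Hom(U', T)), forall u u', b u u' = F u u'.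
Proof.
move=> linr linl.
pose F1 u : {linear U' -> T} :=
  HB.pack (F u) (GRing.isLinear.Build _ _ _ _ _ (linr u)).
have linF : linear (fun u => linfun (F1 u)).
  move=> a u v; apply/lfunP=> w.
  by rewrite !(add_lfunE, scale_lfunE) !lfunE; apply: linl.
by have [b Eb] := linear_lfun linF; exists b => u u'; rewrite Eb lfunE.
Qed.

Lemma trilinear_lfun (U U' U'' T : vectType K) (F : U -> U' -> U'' -> T) :
  (forall u u', linear (F u u')) -> (forall u u'', linear (F u ^~ u'')) ->
  (forall u' u'', linear (fun u => F u u' u'')) ->
  exists b : 'Hom(U, 'Hom(U', 'Hom(U'', T))),
    forall u u' u'', b u u' u'' = F u u' u''.
Proof.
move=> lin3 lin2 lin1.
pose F1 u u' : {linear U'' -> T} :=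
  HB.pack (F u u') (GRing.isLinear.Build _ _ _ _ _ (lin3 u u')).
have [|u'|b Eb] := @bilinear_lfun U U' 'Hom(U'', T)
  (fun u u' => linfun (F1 u u')).
- move=> u a v w; apply/lfunP=> u''.
  by rewrite !(add_lfunE, scale_lfunE) !lfunE; apply: lin2.
- move=> a v w; apply/lfunP=> u''.
  by rewrite !(add_lfunE, scale_lfunE) !lfunE; apply: lin1.
by exists b => u u' u''; rewrite Eb lfunE.
Qed.

End Multilinear.

(** * Linear forms, bilinear forms and their quadrics *)

Section ScalarForms.
Variables (K : fieldType) (V : vectType K).

Lemma lformP (l : 'Hom(V, K^o)) k v w : l (k *: v + w) = k * l v + l w.
Proof. by rewrite linearP. Qed.

Lemma bilDl (c : Bil(V, K^o)) u v w : c (u + v) w = c u w + c v w.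
Proof. by rewrite linearD add_lfunE. Qed.

Lemma bilZl (c : Bil(V, K^o)) k u w : c (k *: u) w = k * c u w.
Proof. by rewrite linearZ scale_lfunE. Qed.

(** The polarization of twice the product of [l] and [m], which avoids dividing by 2. It supplies
    the elements xy, x^2 and yz of [W] on which functionals are tested. *)
Lemma symmetric_product (l m : 'Hom(V, K^o)) : exists b : Bil(V, K^o),
  symmetric_bil b /\ forall u v, b u v = l u * m v + m u * l v.
Proof.
have [||b Eb] := @bilinear_lfun K V V K^o (fun u v => l u * m v + m u * l v).
- by move=> u k v w; rewrite !lformP /GRing.scale /=; ring.
- by move=> u k v w; rewrite !lformP /GRing.scale /=; ring.
by exists b; split=> // u v; rewrite !Eb; ring.
Qed.

Lemma same_quadric_scale (q q' : Bil(V, K^o)) k :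
  k != 0 -> (forall v v', q' v v' = k * q v v') -> same_quadric q q'.
Proof.
move=> k_neq0 qq'; have -> : q' = k *: q.
  by apply/lfunP=> v; apply/lfunP=> v'; rewrite qq' !scale_lfunE.
apply/eqP; rewrite eqEsubv -!memvE.
rewrite [X in X && _](_ : _ = true) ?rpredZ ?memv_line // -[X in X \in _](scalerK k_neq0).
by rewrite rpredZ ?memv_line.
Qed.

End ScalarForms.

(** * Open sets defined by linear forms *)

Section Generic.
Variables (K : fieldType) (V : vectType K).

(** The witness is the product of the forms in [ls], written as polynomials in the coordinates: it
    is nonzero because polynomials over a field form an integral domain. *)
Lemma general_point_linear (ls : seq 'Hom(V, K^o)) (P : V -> Prop) :
  all (fun l => l != 0) ls ->
  (forall u, all (fun l : 'Hom(V, K^o) => l u != 0) ls -> P u) ->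
  general_point P.
Proof.
move=> ls_neq0 Pls; pose b := vbasis {:V}.
pose p (l : 'Hom(V, K^o)) : {mpoly K[\dim {:V}]} := \sum_(i < \dim {:V}) l b`_i *: 'X_i.
have pE l u : (p l).@[fun i => coord b i u] = l u.
  have -> : l u = \sum_(i < \dim {:V}) coord b i u *: l b`_i.
    rewrite [in LHS](coord_vbasis (memvf u)) linear_sum.
    by apply: eq_bigr => i _; rewrite linearZ.
  rewrite /p (raddf_sum (meval _)) /=; apply: eq_bigr => i _.
  by rewrite mevalZ mevalXU mulrC.
exists (size ls), (\prod_(l <- ls) p l); split.
- elim: ls {ls_neq0 Pls} => [|l ls IH]; first by rewrite big_nil dhomog1.
  rewrite big_cons -[size _]/(1 + size ls)%N; apply: dhomogM IH.
  by apply: rpred_sum => i _; apply: rpredZ; rewrite dhomogX /= mdeg1.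
- rewrite prodf_seq_neq0; apply: sub_all ls_neq0 => l /=.
  apply: contraNneq => pl0; apply/eqP/lfunP=> u.
  by rewrite -pE pl0 meval0 zero_lfunE.
- move=> u _; rewrite rmorph_prod prodf_seq_neq0 => pu; apply: Pls.
  by apply: sub_all pu => l /=; rewrite pE.
Qed.

End Generic.

(** * Normal forms of binary quadratic forms *)

Lemma quadratic_root (K : numClosedFieldType) (a b g : K) :
  g != 0 -> exists t, a + 2 * t * b + t ^+ 2 * g = 0.
Proof.
move=> g_neq0; have := sqrtCK (b ^+ 2 - g * a); move: (sqrtC _) => d d2.
exists ((d - b) / g).
have -> : a = (b ^+ 2 - d ^+ 2) / g by rewrite d2; field.
by field.
Qed.

Section BinaryForms.
Variables (K : numClosedFieldType) (U : vectType K) (c : Bil(U, K^o)).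
Hypotheses (dimU : \dim {:U} = 2%N) (c_neq0 : c != 0) (c_sym : symmetric_bil c).

(** For a basis (u, v) with v not isotropic, the form is a polynomial of degree 2 in t along u + t
    v, hence has a root. Freeness keeps u + t v nonzero. *)
Lemma isotropic_vector : exists2 e, e != 0 & c e e = 0.
Proof.
have := vbasisP {:U}; rewrite /basis_of; move: (vbasis _); rewrite dimU => b.
case/tupleP: b => u b; case/tupleP: b => v b; rewrite tuple0 /=.
case/andP=> _; rewrite free_cons span_seq1 => /andP[uNv].
rewrite seq1_free => v_neq0.
have [cvv|cvv] := eqVneq (c v v) 0; first by exists v.
have [t t_root] := quadratic_root (c u u) (c u v) cvv.
exists (u + t *: v).
  apply: contra uNv; rewrite addr_eq0 => /eqP ->.
  by rewrite rpredN rpredZ ?memv_line.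
rewrite bilDl bilZl !linearD !linearZ /= (c_sym v u) -[RHS]t_root.
by rewrite /GRing.scale /=; ring.
Qed.

(** The first alternative is a pair of points, the second a double point. For an isotropic e2, they
    correspond to e2 lying outside or inside the radical of [c]. *)
Lemma binary_form_normal : exists e1 e2, free [:: e1; e2] /\
  ([/\ c e1 e1 = 0, c e2 e2 = 0 & c e1 e2 != 0] \/
   [/\ c e1 e2 = 0, c e2 e2 = 0 & c e1 e1 != 0]).
Proof.
have [e2 e2n ce2] := isotropic_vector.
have two0 : 2 != 0 :> K by rewrite pnatr_eq0.
have [ce|/lfunPn[u]] := eqVneq (c e2) 0; last first.
  rewrite zero_lfunE => cu.
  (* Since e2 is isotropic, c(u - k e2, u - k e2) = c(u, u) - 2 k c(e2, u), and k is its root. *)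
  pose e1 := u - (c u u / (2 * c e2 u)) *: e2.
  have ce1 : c e1 e2 = c e2 u.
    by rewrite bilDl -scaleNr bilZl ce2 mulr0 addr0 c_sym.
  exists e1, e2; split; last first.
    left; split; rewrite ?ce1 // bilDl -scaleNr bilZl !linearD -scaleNr !linearZ /=.
    rewrite ce2 (c_sym u e2) /GRing.scale /=; move: cu.
    by move: (c u u) (c e2 u) => a b b0; field.
  rewrite free_cons seq1_free e2n span_seq1 andbT.
  apply: contra cu => /vlineP[k E].
  by rewrite -ce1 E bilZl ce2 mulr0.
(* Polarization: a nonzero symmetric form cannot vanish at all of u, v and u + v when c(u, v) is
   nonzero. *)
have [e1 ce1] : exists e1, c e1 e1 != 0.
  have /lfunPn[u /lfunPn[v]] := c_neq0; rewrite !zero_lfunE => cuv.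
  have [cu|] := eqVneq (c u u) 0; last by exists u.
  have [cv|] := eqVneq (c v v) 0; last by exists v.
  exists (u + v); rewrite bilDl !linearD /= cu cv (c_sym v u) add0r addr0.
  by rewrite -mulr2n -mulr_natl mulf_neq0.
exists e1, e2; split; last by right; split; rewrite // c_sym ce zero_lfunE.
rewrite free_cons seq1_free e2n span_seq1 andbT.
apply: contra ce1 => /vlineP[k ->].
by rewrite bilZl linearZ /= ce2 scaler0 mulr0.
Qed.

End BinaryForms.

(** * Coordinates adapted to a line *)

Section Coordinates.
Variables (K : fieldType) (V : vectType K).

Record dual_bases (e1 e2 e3 : V) (x y z : 'Hom(V, K^o)) : Prop := DualBases {
  dual_decomp : forall v, v = x v *: e1 + y v *: e2 + z v *: e3;
  dual_x : [/\ x e1 = 1, x e2 = 0 & x e3 = 0];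
  dual_y : [/\ y e1 = 0, y e2 = 1 & y e3 = 0];
  dual_z : [/\ z e1 = 0, z e2 = 0 & z e3 = 1] }.

Lemma dual_bases_adapted (H : {vspace V}) (f1 f2 : subvs_of H) :
  \dim {:V} = 3%N -> \dim H = 2%N -> free [:: f1; f2] ->
  exists e3 x y z, dual_bases (vsval f1) (vsval f2) e3 x y z /\ lker z = H.
Proof.
move=> dimV dimH; rewrite free_cons seq1_free span_seq1 => /andP[f1N f2N].
have f_free : free [:: vsval f1; vsval f2].
  rewrite free_cons seq1_free span_seq1; apply/andP; split.
    by apply: contra f1N => /vlineP[k Ek]; apply/vlineP; exists k; apply: val_inj.
  by apply: contraNneq f2N => f2_0; apply/eqP/val_inj.
have HE : <<[:: vsval f1; vsval f2]>>%VS = H.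
  apply: span_basis; rewrite basisEfree f_free dimH leqnn andbT.
  by apply/span_subvP => u; rewrite !inE => /orP[] /eqP ->; apply: subvsP.
have [e3 _ e3H] : exists2 e3, e3 \in fullv & e3 \notin H.
  by apply/subvPn/negP => /dimvS; rewrite dimV dimH.
(* With e3 in front, freeness reduces to e3 being outside [H]. Hence z is the coordinate of index 0,
   x that of index 1 and y the last one. *)
pose E := [tuple e3; vsval f1; vsval f2].
have E_free : free E by rewrite /= free_cons HE e3H.
have E_basis : basis_of {:V} E by rewrite basisEfree E_free subvf dimV.
have coord_lfun i : exists f : 'Hom(V, K^o), forall v, f v = coord E i v.
  exact: (@linear_lfun K V K^o (coord E i) (linearP _)).
have [[z Ez] [[x Ex] [y Ey]]] := (coord_lfun ord0, (coord_lfun 1, coord_lfun ord_max)).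
have C (i j : 'I_3) : coord E j E`_i = (i == j)%:R.
  exact: coord_free.
have bases : dual_bases (vsval f1) (vsval f2) e3 x y z.
  split.
  - move=> v; rewrite [LHS](coord_basis E_basis (memvf v)).
    rewrite !big_ord_recl big_ord0 /= addr0 Ex Ey Ez addrC.
    by congr (_ *: _ + _ *: _ + _); congr (coord E _ v); apply: val_inj.
  - by split; rewrite Ex; [apply: (C 1) | apply: (C ord_max) | apply: (C ord0)].
  - by split; rewrite Ey; [apply: (C 1) | apply: (C ord_max) | apply: (C ord0)].
  - by split; rewrite Ez; [apply: (C 1) | apply: (C ord_max) | apply: (C ord0)].
exists e3, x, y, z; split=> //.
have [dec _ _ [z1 z2 _]] := bases.
have zH v : v \in H -> z v = 0.
  rewrite -{1}HE span_cons span_seq1 => /memv_addP[_ /vlineP[a ->]].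
  by case=> _ /vlineP[b ->] ->; rewrite linearD !linearZ /= z1 z2 !scaler0 addr0.
apply/vspaceP => v; rewrite memv_ker; apply/eqP/idP => [zv|/zH //].
by rewrite (dec v) zv scale0r addr0 rpredD ?rpredZ ?subvsP.
Qed.

End Coordinates.

(** * The two normal forms of [W] *)

Section NormalForm.
Variables (K : numClosedFieldType) (V : vectType K).

Lemma symmetric_bilE (e1 e2 e3 : V) (x y z : 'Hom(V, K^o)) (q : Bil(V, K^o))
    u v :
  dual_bases e1 e2 e3 x y z -> symmetric_bil q ->
  q u v = x u * x v * q e1 e1 + y u * y v * q e2 e2 + z u * z v * q e3 e3
    + (x u * y v + y u * x v) * q e1 e2 + (x u * z v + z u * x v) * q e1 e3
    + (y u * z v + z u * y v) * q e2 e3.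
Proof.
move=> bases q_sym; rewrite {1}(dual_decomp bases u) {1}(dual_decomp bases v).
rewrite !bilDl !bilZl !linearD !linearZ /= (q_sym e2 e1) (q_sym e3 e1) (q_sym e3 e2).
by rewrite /GRing.scale /=; ring.
Qed.

(** In a normalizing basis of [H], [c] is a multiple of xy or of x^2, with a single nonzero entry.
    Being proportional to [c] means that the other two entries vanish; the factor is then the
    quotient of the remaining entries. *)
Lemma normal_congruence_bases (W : {vspace Bil(V, K^o)}) (H : {vspace V}) :
  \dim {:V} = 3%N -> normal_congruence W H ->
  exists e1 e2 e3 x y z, [/\ dual_bases e1 e2 e3 x y z, lker z = H &
    (forall q, q \in W <-> [/\ symmetric_bil q, q e1 e1 = 0 & q e2 e2 = 0]) \/
    (forall q, q \in W <-> [/\ symmetric_bil q, q e1 e2 = 0 & q e2 e2 = 0])].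
Proof.
move=> dimV [dimH [c [[c_neq0 c_sym] WE]]].
have dimH' : \dim {:subvs_of H} = 2%N by rewrite dimvf.
have [f1 [f2 [f_free f_c]]] := binary_form_normal dimH' c_neq0 c_sym.
have [e3 [x [y [z [bases zH]]]]] := dual_bases_adapted dimV dimH f_free.
have restrictE q u v : restrict H q u v = q (vsval u) (vsval v).
  by rewrite /restrict pullbackE !lfunE.
have subvsE u : u = x (vsval u) *: f1 + y (vsval u) *: f2.
  apply: val_inj; rewrite -[RHS]/(vsval (_ + _)) linearD !linearZ /=.
  rewrite {1}(dual_decomp bases (vsval u)).
  have /eqP -> : z (vsval u) == 0 by rewrite -memv_ker zH subvsP.
  by rewrite scale0r addr0.
have restrict_in q k : symmetric_bil q ->
    q (vsval f1) (vsval f1) = k * c f1 f1 -> q (vsval f1) (vsval f2) = k * c f1 f2 ->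
    q (vsval f2) (vsval f2) = k * c f2 f2 -> restrict H q \in <[c]>%VS.
  move=> q_sym q11 q12 q22; apply/vlineP; exists k; apply/lfunP=> u; apply/lfunP=> v.
  rewrite restrictE !scale_lfunE (symmetric_bilE _ _ bases q_sym).
  have z0 (w : subvs_of H) : z (vsval w) = 0.
    by apply/eqP; rewrite -memv_ker zH subvsP.
  rewrite !z0 q11 q12 q22 [in RHS](subvsE u) [in RHS](subvsE v).
  rewrite !bilDl !bilZl !linearD !linearZ /= (c_sym f2 f1).
  by rewrite /GRing.scale /=; ring.
exists (vsval f1), (vsval f2), e3, x, y, z; split=> //.
case: f_c => -[c1 c2 c3]; [left | right] => q; rewrite WE; split.
- case=> q_sym /vlineP[k Eq].
  by split; rewrite // -restrictE Eq !scale_lfunE ?c1 ?c2 scaler0.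
- case=> q_sym q11 q22; split=> //.
  apply: (@restrict_in _ (q (vsval f1) (vsval f2) / c f1 f2)) => //.
  + by rewrite c1 mulr0.
  + by rewrite divfK.
  + by rewrite c2 mulr0.
- case=> q_sym /vlineP[k Eq].
  by split; rewrite // -restrictE Eq !scale_lfunE ?c1 ?c2 scaler0.
- case=> q_sym q12 q22; split=> //.
  apply: (@restrict_in _ (q (vsval f1) (vsval f1) / c f1 f1)) => //.
  + by rewrite divfK.
  + by rewrite c1 mulr0.
  + by rewrite c2 mulr0.
Qed.

End NormalForm.

(** * Coefficients of a polynomial identity *)

Lemma natrS_mul_eq0 (K : numFieldType) n (t : K) : n.+1%:R * t = 0 -> t = 0.
Proof. by move/eqP; rewrite mulf_eq0 pnatr_eq0 => /eqP. Qed.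

(** These are the monomials that can occur in sigma(u)(u) for u = p e1 + q e2 + e3, in both cases.
    In characteristic 0, values at a few small integers separate their coefficients. *)
Lemma cubic_coef_eq0 (K : numFieldType) (a b c d e f g h i : K) :
  (forall p q, a + b * p + c * q + d * p ^+ 2 + e * q ^+ 2 + f * (p * q)
     + g * (p ^+ 2 * q) + h * (p * q ^+ 2) + i * p ^+ 3 = 0) ->
  [/\ [/\ a = 0, b = 0 & c = 0], [/\ d = 0, e = 0 & f = 0]
    & [/\ g = 0, h = 0 & i = 0]].
Proof.
move=> E.
have comb (k s t : K) : s = 0 -> t = 0 -> s + k * t = 0.
  by move=> -> ->; rewrite mulr0 addr0.
have a0 : a = 0 by rewrite -(E 0 0); ring.
have d0 : d = 0.
  by subst a; apply: (@natrS_mul_eq0 K 1); rewrite -[RHS](comb 1 _ _ (E 1 0) (E (-1) 0)); ring.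
have i0 : i = 0.
  (* The value at (2, 0) minus twice the value at (1, 0) is 6 i; the index 5 stands for the factor
     6. *)
  by subst a d; apply: (@natrS_mul_eq0 K 5);
     rewrite -[RHS](comb (-2) _ _ (E 2 0) (E 1 0)); ring.
have b0 : b = 0 by subst a d i; rewrite -(E 1 0); ring.
have e0 : e = 0.
  by subst a; apply: (@natrS_mul_eq0 K 1); rewrite -[RHS](comb 1 _ _ (E 0 1) (E 0 (-1))); ring.
have c0 : c = 0 by subst a e; rewrite -(E 0 1); ring.
subst a b c d e i.
have g0 : g = 0.
  by apply: (@natrS_mul_eq0 K 1); rewrite -[RHS](comb 1 _ _ (E 1 1) (E (-1) 1)); ring.
have h0 : h = 0.
  by apply: (@natrS_mul_eq0 K 1); rewrite -[RHS](comb 1 _ _ (E 1 1) (E 1 (-1))); ring.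
by subst g h; split; split=> //; rewrite -(E 1 1); ring.
Qed.

(** * Preimages of one conic under a quadratic matrix *)

Definition trilinear (K : fieldType) (V : vectType K) (F : V -> V -> V -> K) :=
  [/\ forall u u' k v w, F u u' (k *: v + w) = k * F u u' v + F u u' w,
      forall u u' k v w, F u (k *: v + w) u' = k * F u v u' + F u w u'
    & forall u u' k v w, F (k *: v + w) u u' = k * F v u u' + F w u u'].

(** The common target of the two cases. Pulling [q0] back along [r x x] gives the equation of the
    preimage of C0, and a trivial kernel makes this endomorphism invertible. [r] need not be
    symmetric. *)
Definition images_of_one_conic (K : fieldType) (V : vectType K)
    (W : {vspace Bil(V, K^o)}) (s : Bil(V, subvs_of W)) : Prop :=
  exists (r : Bil(V, 'End(V))) (q0 : Bil(V, K^o)),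
    quadric_equation q0 /\
    general_point (fun x : V =>
      [/\ s x x != 0, lker (r x x) = 0%VS
        & same_quadric (vsval (s x x)) (pullback (r x x) q0)]).

Section Conclusion.
Variables (K : numClosedFieldType) (V : vectType K).
Variables (W : {vspace Bil(V, K^o)}) (s : Bil(V, subvs_of W)).
Variables (e1 e2 e3 : V) (x y z : 'Hom(V, K^o)).
Hypothesis bases : dual_bases e1 e2 e3 x y z.

(* X, Y, Z are the components of R, and C0 has the equation
   al x^2 + 2 be xy + 2 ga yz + de z^2. *)
Lemma conic_image_general (al be ga de : K) (X Y Z : V -> V -> V -> K)
    (ls : seq 'Hom(V, K^o)) :
  (be != 0) || (ga != 0) -> trilinear X -> trilinear Y -> trilinear Z ->
  all (fun l => l != 0) ls ->
  (forall u, all (fun l : 'Hom(V, K^o) => l u != 0) ls ->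
    [/\ s u u != 0,
      forall v, X u u v = 0 -> Y u u v = 0 -> Z u u v = 0 ->
        [/\ x v = 0, y v = 0 & z v = 0]
    & exists2 k, k != 0 & forall v v',
        al * (X u u v * X u u v') + be * (X u u v * Y u u v' + Y u u v * X u u v')
        + ga * (Y u u v * Z u u v' + Z u u v * Y u u v') + de * (Z u u v * Z u u v')
        = k * vsval (s u u) v v']) ->
  images_of_one_conic s.
Proof.
move=> be_ga [X3 X2 X1] [Y3 Y2 Y1] [Z3 Z2 Z1] ls_neq0 ls_generic.
have [x1 x2 x3] := dual_x bases; have [y1 y2 y3] := dual_y bases.
have [z1 z2 z3] := dual_z bases.
have [||| r Er] := @trilinear_lfun K V V V V
  (fun u u' v => X u u' v *: e1 + Y u u' v *: e2 + Z u u' v *: e3).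
- move=> u u' k v w /=; rewrite X3 Y3 Z3 !scalerDl -!scalerA !scalerDr.
  by rewrite [RHS]addrACA; congr (_ + _); rewrite [RHS]addrACA.
- move=> u v k w w' /=; rewrite X2 Y2 Z2 !scalerDl -!scalerA !scalerDr.
  by rewrite [RHS]addrACA; congr (_ + _); rewrite [RHS]addrACA.
- move=> u v k w w' /=; rewrite X1 Y1 Z1 !scalerDl -!scalerA !scalerDr.
  by rewrite [RHS]addrACA; congr (_ + _); rewrite [RHS]addrACA.
have [xr yr zr] : [/\ forall u u' v, x (r u u' v) = X u u' v,
    forall u u' v, y (r u u' v) = Y u u' v & forall u u' v, z (r u u' v) = Z u u' v].
  by split=> u u' v; rewrite Er !linearD !linearZ /= ?x1 ?x2 ?x3 ?y1 ?y2 ?y3 ?z1 ?z2 ?z3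
    /GRing.scale /=; ring.
have [|| q0 Eq0] := @bilinear_lfun K V V K^o (fun v v' =>
  al * (x v * x v') + be * (x v * y v' + y v * x v')
  + ga * (y v * z v' + z v * y v') + de * (z v * z v')).
- by move=> u k v w; rewrite !lformP /GRing.scale /=; ring.
- by move=> u k v w; rewrite !lformP /GRing.scale /=; ring.
exists r, q0; split.
  split; last by move=> u v; rewrite !Eq0; ring.
  (* [be] and [ga] are the entries of [q0] at (e1, e2) and (e2, e3), so [q0] is nonzero. *)
  apply: contraTneq be_ga => q0_0; rewrite negb_or !negbK.
  have := Eq0 e1 e2; have := Eq0 e2 e3; rewrite q0_0 !zero_lfunE.
  rewrite x1 x2 x3 y1 y2 y3 z1 z2 z3 !(mulr0, mul0r, mulr1, addr0, add0r).
  by move=> <- <-; rewrite eqxx.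
apply: general_point_linear ls_neq0 _ => u /ls_generic[suu ker_u [k k_neq0 Ek]].
split=> //.
  apply/eqP; rewrite -subv0; apply/subvP=> v; rewrite memv_ker memv0 => /eqP rv.
  have [||| xv yv zv] := ker_u v; rewrite -?xr -?yr -?zr ?rv ?linear0 //.
  by rewrite (dual_decomp bases v) xv yv zv !scale0r !addr0.
apply: (same_quadric_scale k_neq0) => v v'.
by rewrite pullbackE Eq0 !xr !yr !zr Ek.
Qed.

End Conclusion.

(** * Entries of the equation of sigma(u) *)

Section Congruence.
Variables (K : numClosedFieldType) (V : vectType K).
Variables (W : {vspace Bil(V, K^o)}) (s : Bil(V, subvs_of W)).
Hypothesis congruence_s : quadratic_congruence s.
Variables (e1 e2 e3 : V) (x y z : 'Hom(V, K^o)).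
Hypothesis bases : dual_bases e1 e2 e3 x y z.
Hypothesis L_eq_H : is_Lsigma s (lker z) (lker z).

Lemma entry_functional (a b : V) : exists L : 'Hom(subvs_of W, K^o),
  (forall w, L w = vsval w a b) /\
  forall u u', sigma_star s L u u' = vsval (s u u') a b.
Proof.
have [|L EL] := @linear_lfun K (subvs_of W) K^o (fun w => vsval w a b).
  by move=> k w w'; rewrite linearP !(add_lfunE, scale_lfunE).
by exists L; split=> // u u'; rewrite sigma_starE EL.
Qed.

(** This is where the image of sigma^* being [W] enters: each entry, as a quadratic form in the
    point, is again the equation of a conic through C, or zero. *)
Lemma entry_in_W (a b : V) :
  exists2 q, q \in W & forall u u', q u u' = vsval (s u u') a b.
Proof.
have [L [_ EL]] := entry_functional a b.
exists (sigma_star s L) => //; have := memv_img (sigma_star s) (memvf L).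
by rewrite (congr_img congruence_s).
Qed.

Lemma vsval_sym u u' : symmetric_bil (vsval (s u u')).
Proof. exact/(congr_symW congruence_s)/subvsP. Qed.

Lemma incident u : vsval (s u u) u u = 0.
Proof.
have [->|/(congr_incident congruence_s)//] := eqVneq (s u u) 0.
by rewrite linear0 !zero_lfunE.
Qed.

(** Both linear factors of the constant value have kernel H, so they are multiples of z and sigma is
    a multiple of z^2 at points of H. Polarizing this, in the argument and then in the point, gives
    the claim. *)
Lemma sigma_constant_on_H u u' a b :
  z u = 0 -> z u' = 0 -> z b = 0 -> vsval (s u u') a b = 0.
Proof.
have two_neq0 : 2 != 0 :> K by rewrite pnatr_eq0.
have [_ [q [_ [h [l [h_z l_z q_hl]]] s_q]]] := L_eq_H.
have prop_z (k : 'Hom(V, K^o)) : lker k = lker z -> forall v, k v = k e3 * z v.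
  move=> kz v; have : v - z v *: e3 \in lker z.
    have [_ _ z3] := dual_z bases.
    by rewrite memv_ker linearB linearZ /= z3 /GRing.scale /= mulr1 subrr.
  rewrite -kz memv_ker linearB linearZ /= subr_eq0 => /eqP ->.
  by rewrite /GRing.scale /= mulrC.
have diag v : z v = 0 -> z b = 0 -> vsval (s v v) a b = 0.
  move=> zv zb; have [->|svv] := eqVneq (s v v) 0.
    by rewrite linear0 !zero_lfunE.
  have vH : v \in lker z by rewrite memv_ker zv.
  have /vlineP[k Ek] : vsval (s v v) \in <[q]>%VS.
    by rewrite -(s_q _ vH svv) memv_line.
  have E t : vsval (s v v) t t = k * (h e3 * l e3) * (z t * z t).
    by rewrite Ek !scale_lfunE q_hl (prop_z h) // (prop_z l) // /GRing.scale /=; ring.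
  (* As z vanishes at b, the form takes equal values at a + b and a, and 0 at b; so twice the mixed
     term is 0. *)
  have := E (a + b); rewrite bilDl !linearD /= !E zb (@vsval_sym v v b a).
  move: (vsval (s v v) a b) => w Ew; apply: (mulfI two_neq0); rewrite mulr0.
  apply: (addrI (k * (h e3 * l e3) * (z a * z a))).
  by rewrite addr0; move: Ew; rewrite !addr0 => Ew; rewrite -[RHS]Ew; ring.
move=> zu zu' zb; have := diag (u + u'); rewrite [z _]linearD /= zu zu' addr0.
move=> /(_ erefl zb).
have -> : s (u + u') (u + u') = s u u + s u' u' + (s u u' + s u u').
  rewrite [s (u + u')]linearD add_lfunE !linearD /= (congr_sym congruence_s u' u).
  by rewrite [s u u' + s u' u']addrC addrACA.
rewrite !linearD !add_lfunE /= !diag // !add0r => /eqP.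
by rewrite -mulr2n -mulr_natl mulf_eq0 (negPf two_neq0) => /eqP.
Qed.

(** The first two arguments select an entry of the equation, the last two are the polarized point;
    on basis vectors, [M] lists the coefficients of sigma. *)
Let M a b u u' : K := vsval (s u u') a b.

(** Injectivity of sigma^* means that the values of sigma span [W]. Polarization passes from the
    values [s u u] to the bilinear form [sigma_star s L]. *)
Lemma functional_eq0 (L : 'Hom(subvs_of W, K^o)) :
  (forall u, L (s u u) = 0) -> forall w, L w = 0.
Proof.
move=> L_s w; have /eqP -> : L == 0; last by rewrite zero_lfunE.
rewrite -memv0 -(congr_inj congruence_s) memv_ker; apply/eqP.
apply/lfunP=> u; apply/lfunP=> u'; rewrite sigma_starE !zero_lfunE.
have := L_s (u + u'); rewrite [s (u + u')]linearD add_lfunE !linearD /= !L_s.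
rewrite (congr_sym congruence_s u' u) add0r addr0 -mulr2n -mulr_natl => /eqP.
by rewrite mulf_eq0 pnatr_eq0 => /eqP.
Qed.

(** * The case where C is two distinct points *)

Section TwoPoints.
Hypothesis W_two_points :
  forall q, q \in W <-> [/\ symmetric_bil q, q e1 e1 = 0 & q e2 e2 = 0].

Lemma two_points_vsval u u' v v' :
  M v v' u u' = z v * z v' * M e3 e3 u u' + (x v * y v' + y v * x v') * M e1 e2 u u'
   + (x v * z v' + z v * x v') * M e1 e3 u u' + (y v * z v' + z v * y v') * M e2 e3 u u'.
Proof.
rewrite /M; have /W_two_points[q_sym q11 q22] := subvsP (s u u').
by rewrite (symmetric_bilE v v' bases q_sym) q11 q22; ring.
Qed.

(** By [entry_in_W], the expansion in the point lacks the same two terms as the expansion in the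
    argument. *)
Lemma two_points_entry a b u u' :
  M a b u u' = z u * z u' * M a b e3 e3 + (x u * y u' + y u * x u') * M a b e1 e2
   + (x u * z u' + z u * x u') * M a b e1 e3 + (y u * z u' + z u * y u') * M a b e2 e3.
Proof.
have [q /W_two_points[q_sym q11 q22] Eq] := entry_in_W a b.
by rewrite /M -!Eq (symmetric_bilE u u' bases q_sym) q11 q22; ring.
Qed.

(** The behaviour on H kills the (e1, e2) coefficient of every entry but (e3, e3), the only one
    where z^2 contributes. Incidence then leaves five free scalars. *)
Lemma two_points_equations :
  [/\ forall u, M e1 e2 u u = M e1 e2 e3 e3 * z u ^+ 2,
      forall u, M e1 e3 u u = z u * (2 * M e1 e3 e2 e3 * y u + M e1 e3 e3 e3 * z u),
      forall u, M e2 e3 u u = z u * (2 * M e2 e3 e1 e3 * x u + M e2 e3 e3 e3 * z u)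
    & forall u, M e3 e3 u u = - 2 * (M e1 e3 e3 e3 * x u * z u + M e2 e3 e3 e3 * y u * z u
        + (2 * M e1 e3 e2 e3 + 2 * M e2 e3 e1 e3 + M e1 e2 e3 e3) * x u * y u)].
Proof.
have [x1 x2 x3] := dual_x bases; have [y1 y2 y3] := dual_y bases.
have [z1 z2 z3] := dual_z bases.
have H0 a b : z b = 0 -> M a b e1 e2 = 0.
  by move=> zb; apply: sigma_constant_on_H.
have E12 := H0 e1 e2 z2.
have E13 : M e1 e3 e1 e2 = 0 by rewrite /M vsval_sym //; apply: H0.
have E23 : M e2 e3 e1 e2 = 0 by rewrite /M vsval_sym //; apply: H0.
(* The coefficients of 1, p, q, p^2, q^2, pq, p^2 q, p q^2 and p^3 in sigma(u)(u). *)
have [] := @cubic_coef_eq0 K (M e3 e3 e3 e3) (2 * (M e3 e3 e1 e3 + M e1 e3 e3 e3))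
  (2 * (M e3 e3 e2 e3 + M e2 e3 e3 e3)) (4 * M e1 e3 e1 e3) (4 * M e2 e3 e2 e3)
  (2 * (M e3 e3 e1 e2 + M e1 e2 e3 e3 + 2 * M e1 e3 e2 e3 + 2 * M e2 e3 e1 e3))
  (4 * M e1 e2 e1 e3) (4 * M e1 e2 e2 e3) 0.
  move=> p q; have := incident (p *: e1 + q *: e2 + e3).
  rewrite -/(M _ _ _ _) two_points_vsval.
  rewrite !(two_points_entry _ _ (_ + _)) E12 E13 E23.
  rewrite !linearD !linearZ /= x1 x2 x3 y1 y2 y3 z1 z2 z3 /GRing.scale /=.
  by move=> inc; rewrite -[RHS]inc; ring.
move=> [E3333 Eb Ec] [Ed Ee Ef] [Eg Eh _].
have {Eb} E3313 := addr0_eq (@natrS_mul_eq0 K 1 _ Eb).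
have {Ec} E3323 := addr0_eq (@natrS_mul_eq0 K 1 _ Ec).
have {Ed} E1313 := @natrS_mul_eq0 K 3 _ Ed; have {Ee} E2323 := @natrS_mul_eq0 K 3 _ Ee.
have {Eg} E1213 := @natrS_mul_eq0 K 3 _ Eg; have {Eh} E1223 := @natrS_mul_eq0 K 3 _ Eh.
have {Ef} E3312 : M e3 e3 e1 e2 = - (M e1 e2 e3 e3 + 2 * M e1 e3 e2 e3 + 2 * M e2 e3 e1 e3).
  by apply/eqP; rewrite -addr_eq0 -(@natrS_mul_eq0 K 1 _ Ef); apply/eqP; ring.
split=> u; rewrite two_points_entry.
- by rewrite E12 E1213 E1223; ring.
- by rewrite E13 E1313; ring.
- by rewrite E23 E2323; ring.
- by rewrite E3333 E3312 -E3313 -E3323; ring.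
Qed.

(** Otherwise the (e1, e2) entry would vanish at all values of sigma, hence on [W], which contains
    xy. *)
Lemma two_points_M12_neq0 : M e1 e2 e3 e3 != 0.
Proof.
apply/eqP => M12; have [E12 _ _ _] := two_points_equations.
have [L [EL _]] := entry_functional e1 e2.
have [q [q_sym Eq]] := symmetric_product x y.
have [x1 x2 x3] := dual_x bases; have [y1 y2 y3] := dual_y bases.
have qW : q \in W.
  by apply/W_two_points; split; rewrite ?Eq ?x2 ?y1 ?mulr0 ?mul0r ?addr0.
suff /(_ (Subvs qW)) : forall w, L w = 0.
  by rewrite EL /= Eq x1 x2 y1 y2 mulr1 mul0r addr0 => /eqP; rewrite oner_eq0.
by apply: functional_eq0 => u; rewrite EL -/(M _ _ _ _) E12 M12 mul0r.
Qed.

Lemma two_points_image : images_of_one_conic s.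
Proof.
have f_neq0 := two_points_M12_neq0.
have [E12 E13 E23 E33] := two_points_equations.
have [x1 x2 x3] := dual_x bases; have [y1 y2 y3] := dual_y bases.
have [z1 z2 z3] := dual_z bases.
move: E12 E13 E23 E33 f_neq0.
set f := M e1 e2 e3 e3; set b := M e1 e3 e3 e3; set d := M e2 e3 e3 e3.
set A := 2 * M e1 e3 e2 e3; set B := 2 * M e2 e3 e1 e3 => E12 E13 E23 E33 f_neq0.
have ME u v v' : vsval (s u u) v v' =
    f * z u ^+ 2 * (x v * y v' + y v * x v')
    + z u * (A * y u + b * z u) * (x v * z v' + z v * x v')
    + z u * (B * x u + d * z u) * (y v * z v' + z v * y v')
    - 2 * (b * x u * z u + d * y u * z u + (A + B + f) * x u * y u) * z v * z v'.
  by rewrite -[LHS]/(M v v' u u) two_points_vsval E12 E13 E23 E33; ring.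
have s_neq0 u : z u != 0 -> s u u != 0.
  move=> zu; have : f * z u ^+ 2 != 0 by rewrite mulf_neq0 ?expf_neq0.
  by rewrite -E12; apply: contra => /eqP su; rewrite /M su linear0 !zero_lfunE.
have z_neq0 : z != 0.
  by apply: contra_eqN z3 => /eqP ->; rewrite zero_lfunE eq_sym oner_eq0.
(* Put r = z(u), m1 = A y(u) + b r and m2 = B x(u) + d r. At the argument u itself, X = f r x + m2 z
   and Y = f r y + m1 z take the values r l1(u) and r l2(u), so incidence forces the term - l1 l2
   z^2. *)
pose l1 : 'Hom(V, K^o) := (f + B) *: x + d *: z.
pose l2 : 'Hom(V, K^o) := (f + A) *: y + b *: z.
have l1E u : l1 u = (f + B) * x u + d * z u by rewrite add_lfunE !scale_lfunE.
have l2E u : l2 u = (f + A) * y u + b * z u by rewrite add_lfunE !scale_lfunE.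
(* The vanishing of the coefficient of p q r^2 in sigma(u)(u), used in E33, makes
   this discriminant factor. *)
have l12E u : f * (b * x u * z u + d * y u * z u + (A + B + f) * x u * y u)
    = l1 u * l2 u - (A * y u + b * z u) * (B * x u + d * z u).
  by rewrite l1E l2E; ring.
have [l12|/norP[l1_neq0 l2_neq0]] := boolP ((l1 == 0) || (l2 == 0)).
  have l12_0 u : l1 u * l2 u = 0.
    by case/orP: l12 => /eqP ->; rewrite zero_lfunE ?mul0r ?mulr0.
  apply: (@conic_image_general K V W s e1 e2 e3 x y z bases 0 1 0 0
    (fun u u' v => z u * (f * z u' * x v + (B * x u' + d * z u') * z v))
    (fun u u' v => z u * (f * z u' * y v + (A * y u' + b * z u') * z v))
    (fun u u' v => z u * z u' * z v) [:: z]).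
  - by rewrite oner_eq0.
  - by split=> u u' k v w /=; rewrite !lformP; ring.
  - by split=> u u' k v w /=; rewrite !lformP; ring.
  - by split=> u u' k v w /=; rewrite !lformP; ring.
  - by rewrite /= z_neq0.
  move=> u /andP[zu _]; split; first exact: s_neq0.
    move=> v + + /eqP; rewrite !mulf_eq0 (negPf zu) /= => Xv Yv /eqP zv.
    move: Xv Yv; rewrite zv !mulr0 !addr0 => /eqP + /eqP.
    by rewrite !mulf_eq0 (negPf zu) (negPf f_neq0) /= => /eqP -> /eqP ->.
  exists (f * z u ^+ 2); first by rewrite mulf_neq0 ?expf_neq0.
  move=> v v'; rewrite ME; set N := b * x u * z u + _ + _.
  have fN : f * N = - ((A * y u + b * z u) * (B * x u + d * z u)).
    by rewrite l12E l12_0 sub0r.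
  (* The factor f brings out f N, which [fN] can replace. *)
  transitivity (f * z u ^+ 2 * (f * z u ^+ 2 * (x v * y v' + y v * x v')
    + z u * (A * y u + b * z u) * (x v * z v' + z v * x v')
    + z u * (B * x u + d * z u) * (y v * z v' + z v * y v'))
    - 2 * z u ^+ 2 * (f * N) * z v * z v'); first by rewrite fN; ring.
  by ring.
(* The [be] term is 2 XY on the diagonal, so C0 : xy = z^2 needs [de] = -2. *)
apply: (@conic_image_general K V W s e1 e2 e3 x y z bases 0 1 0 (- 2)
    (fun u u' v => l1 u * (f * z u' * x v + (B * x u' + d * z u') * z v))
    (fun u u' v => l2 u * (f * z u' * y v + (A * y u' + b * z u') * z v))
    (fun u u' v => l1 u * l2 u' * z v) [:: z; l1; l2]).
- by rewrite oner_eq0.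
- by split=> u u' k v w /=; rewrite !lformP; ring.
- by split=> u u' k v w /=; rewrite !lformP; ring.
- by split=> u u' k v w /=; rewrite !lformP; ring.
- by rewrite /= z_neq0 l1_neq0 l2_neq0.
move=> u /and4P[zu l1u l2u _]; split; first exact: s_neq0.
  move=> v + + /eqP; rewrite !mulf_eq0 (negPf l1u) (negPf l2u) /= => Xv Yv /eqP zv.
  move: Xv Yv; rewrite zv !mulr0 !addr0 => /eqP + /eqP.
  rewrite !mulf_eq0 (negPf l1u) (negPf l2u) (negPf zu) (negPf f_neq0) /=.
  by move=> /eqP -> /eqP ->.
exists (f * (l1 u * l2 u)); first by rewrite !mulf_neq0.
move=> v v'; rewrite ME; set N := b * x u * z u + _ + _.
have fN : f * N = l1 u * l2 u - (A * y u + b * z u) * (B * x u + d * z u) by rewrite l12E.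
transitivity (l1 u * l2 u * (f * (f * z u ^+ 2 * (x v * y v' + y v * x v')
    + z u * (A * y u + b * z u) * (x v * z v' + z v * x v')
    + z u * (B * x u + d * z u) * (y v * z v' + z v * y v'))
    - 2 * (f * N) * z v * z v')); first by rewrite fN; ring.
by ring.
Qed.

End TwoPoints.

(** * The case where C is a double point *)

Section DoublePoint.
Hypothesis W_double_point :
  forall q, q \in W <-> [/\ symmetric_bil q, q e1 e2 = 0 & q e2 e2 = 0].

Lemma double_point_vsval u u' v v' :
  M v v' u u' = x v * x v' * M e1 e1 u u' + z v * z v' * M e3 e3 u u'
   + (x v * z v' + z v * x v') * M e1 e3 u u' + (y v * z v' + z v * y v') * M e2 e3 u u'.
Proof.
rewrite /M; have /W_double_point[q_sym q12 q22] := subvsP (s u u').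
by rewrite (symmetric_bilE v v' bases q_sym) q12 q22; ring.
Qed.

Lemma double_point_entry a b u u' :
  M a b u u' = x u * x u' * M a b e1 e1 + z u * z u' * M a b e3 e3
   + (x u * z u' + z u * x u') * M a b e1 e3 + (y u * z u' + z u * y u') * M a b e2 e3.
Proof.
have [q /W_double_point[q_sym q12 q22] Eq] := entry_in_W a b.
by rewrite /M -!Eq (symmetric_bilE u u' bases q_sym) q12 q22; ring.
Qed.

(** The (e1, e1) entry isolates the x^2 term, and the (e2, e3) entry gives the y coefficient of T,
    on which the invertibility of R depends. The entries (e1, e3) and (e3, e3) go into T as they
    are. *)
Lemma double_point_equations :
  (forall u, M e1 e1 u u = M e1 e1 e3 e3 * z u ^+ 2) /\
  (forall u, M e2 e3 u u = z u * (2 * M e2 e3 e1 e3 * x u + M e2 e3 e3 e3 * z u)).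
Proof.
have [x1 x2 x3] := dual_x bases; have [y1 y2 y3] := dual_y bases.
have [z1 z2 z3] := dual_z bases.
have H0 a b : z b = 0 -> M a b e1 e1 = 0.
  by move=> zb; apply: sigma_constant_on_H.
have E11 := H0 e1 e1 z1.
have E13 : M e1 e3 e1 e1 = 0 by rewrite /M vsval_sym //; apply: H0.
have E23 : M e2 e3 e1 e1 = 0 by rewrite /M vsval_sym //; apply: H0.
have [] := @cubic_coef_eq0 K (M e3 e3 e3 e3) (2 * (M e3 e3 e1 e3 + M e1 e3 e3 e3))
  (2 * (M e3 e3 e2 e3 + M e2 e3 e3 e3))
  (4 * M e1 e3 e1 e3 + M e3 e3 e1 e1 + M e1 e1 e3 e3) (4 * M e2 e3 e2 e3)
  (4 * (M e1 e3 e2 e3 + M e2 e3 e1 e3)) (2 * M e1 e1 e2 e3) 0 (2 * M e1 e1 e1 e3).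
  move=> p q; have := incident (p *: e1 + q *: e2 + e3).
  rewrite -/(M _ _ _ _) double_point_vsval.
  rewrite !(double_point_entry _ _ (_ + _)) E11 E13 E23.
  rewrite !linearD !linearZ /= x1 x2 x3 y1 y2 y3 z1 z2 z3 /GRing.scale /=.
  by move=> inc; rewrite -[RHS]inc; ring.
move=> _ [_ Ee _] [Eg _ Ei].
have {Ee} E2323 := @natrS_mul_eq0 K 3 _ Ee.
have {Eg} E1123 := @natrS_mul_eq0 K 1 _ Eg; have {Ei} E1113 := @natrS_mul_eq0 K 1 _ Ei.
split=> u; rewrite double_point_entry.
- by rewrite E11 E1113 E1123; ring.
- by rewrite E23 E2323; ring.
Qed.

Lemma double_point_M11_neq0 : M e1 e1 e3 e3 != 0.
Proof.
apply/eqP => M11; have [E11 _] := double_point_equations.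
have [L [EL _]] := entry_functional e1 e1.
have [q [q_sym Eq]] := symmetric_product x x.
have [x1 x2 x3] := dual_x bases.
have qW : q \in W.
  by apply/W_double_point; split; rewrite ?Eq ?x2 ?mulr0 ?mul0r ?addr0.
suff /(_ (Subvs qW)) : forall w, L w = 0.
  by rewrite EL /= Eq x1 mulr1 => /eqP; rewrite (pnatr_eq0 K 2).
by apply: functional_eq0 => u; rewrite EL -/(M _ _ _ _) E11 M11 mul0r.
Qed.

(** Otherwise the (e2, e3) and (e1, e1) entries of sigma(u) would both be multiples of z(u)^2. A
    combination of them would vanish on [W], but its value at yz is [M e1 e1 e3 e3], which is
    nonzero. *)
Lemma double_point_M23_neq0 : M e2 e3 e1 e3 != 0.
Proof.
apply/eqP => M23; have [E11 E23] := double_point_equations.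
have [L [EL _]] := entry_functional e1 e1.
have [L' [EL' _]] := entry_functional e2 e3.
have [q [q_sym Eq]] := symmetric_product y z.
have [y1 y2 y3] := dual_y bases; have [z1 z2 z3] := dual_z bases.
have qW : q \in W.
  by apply/W_double_point; split; rewrite ?Eq ?y1 ?z1 ?z2 ?mulr0 ?mul0r ?addr0.
pose L'' := M e1 e1 e3 e3 *: L' - M e2 e3 e3 e3 *: L.
have EL'' w : L'' w = M e1 e1 e3 e3 * vsval w e2 e3 - M e2 e3 e3 e3 * vsval w e1 e1.
  by rewrite add_lfunE opp_lfunE !scale_lfunE EL EL'.
suff /(_ (Subvs qW)) : forall w, L'' w = 0.
  rewrite EL'' /= !Eq y1 y2 y3 z1 z2 z3 !(mulr0, mul0r, addr0, mulr1, subr0).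
  by move/eqP; rewrite (negPf double_point_M11_neq0).
apply: functional_eq0 => u; rewrite EL'' -[vsval (s u u) e2 e3]/(M e2 e3 u u)
  -[vsval (s u u) e1 e1]/(M e1 e1 u u).
by rewrite (E11 u) (E23 u) M23; ring.
Qed.

Lemma double_point_image : images_of_one_conic s.
Proof.
have f_neq0 := double_point_M11_neq0; have a_neq0 := double_point_M23_neq0.
have [E11 E23] := double_point_equations.
have [x1 x2 x3] := dual_x bases; have [y1 y2 y3] := dual_y bases.
have [z1 z2 z3] := dual_z bases.
have two_neq0 : 2 != 0 :> K by rewrite pnatr_eq0.
have s_neq0 u : z u != 0 -> s u u != 0.
  move=> zu; have : M e1 e1 e3 e3 * z u ^+ 2 != 0 by rewrite mulf_neq0 ?expf_neq0.
  by rewrite -E11; apply: contra => /eqP su; rewrite /M su linear0 !zero_lfunE.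
have z_neq0 : z != 0.
  by apply: contra_eqN z3 => /eqP ->; rewrite zero_lfunE eq_sym oner_eq0.
(* The coefficient of y in T is 2 z(u) m(u), so R(u) is invertible where z and m do not vanish. *)
pose m : 'Hom(V, K^o) := (2 * M e2 e3 e1 e3) *: x + M e2 e3 e3 e3 *: z.
have mE u : m u = 2 * M e2 e3 e1 e3 * x u + M e2 e3 e3 e3 * z u.
  by rewrite add_lfunE !scale_lfunE.
have m_neq0 : m != 0.
  apply: contraTneq a_neq0 => m0; have := mE e1; rewrite m0 zero_lfunE x1 z1.
  by rewrite mulr0 addr0 mulr1 => /esym/eqP; rewrite mulf_eq0 (negPf two_neq0) negbK.
have MP a b k u v u' : M a b (k *: u + v) u' = k * M a b u u' + M a b v u'.
  by rewrite /M !(linearP, add_lfunE, scale_lfunE).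
have MP' a b k u v u' : M a b u' (k *: u + v) = k * M a b u' u + M a b u' v.
  by rewrite /M !(linearP, add_lfunE, scale_lfunE).
(* C0 is f x^2 + yz = 0 with f = [M e1 e1 e3 e3], doubled because the [ga] term is 2 YZ on the
   diagonal. *)
apply: (@conic_image_general K V W s e1 e2 e3 x y z bases (2 * M e1 e1 e3 e3) 0 1 0
    (fun u u' v => z u * z u' * x v)
    (fun u u' v => 2 * M e1 e3 u u' * x v + 2 * M e2 e3 u u' * y v + M e3 e3 u u' * z v)
    (fun u u' v => z u * z u' * z v) [:: z; m]).
- by rewrite oner_eq0 orbT.
- by split=> u u' k v w /=; rewrite !lformP; ring.
- by split=> u u' k v w /=; rewrite ?MP ?MP' ?lformP; ring.
- by split=> u u' k v w /=; rewrite !lformP; ring.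
- by rewrite /= z_neq0 m_neq0.
move=> u /and3P[zu mu _]; split; first exact: s_neq0.
  move=> v /eqP + + /eqP; rewrite !mulf_eq0 (negPf zu) /= => /eqP xv Yv /eqP zv.
  move: Yv; rewrite xv zv !mulr0 add0r addr0 E23 -mE => /eqP.
  by rewrite !mulf_eq0 (negPf two_neq0) (negPf zu) (negPf mu) /= => /eqP ->.
exists (2 * z u ^+ 2); first by rewrite mulf_neq0 ?expf_neq0.
move=> v v'; rewrite -[vsval (s u u) v v']/(M v v' u u).
by rewrite (double_point_vsval u u v v') (E11 u); ring.
Qed.

End DoublePoint.
End Congruence.

(** * The two cases combined *)

Theorem proposition5p3p4 (R : realType) (V : vectType R[i])
    (dimV : \dim {:V} = 3%N)
    (W : {vspace Bil(V, R[i]^o)}) (s : Bil(V, subvs_of W)) (H : {vspace V})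
    (congruence_s : quadratic_congruence s)
    (normal_W : normal_congruence W H)
    (L_eq_H : is_Lsigma s H H) :
  exists (r : Bil(V, 'End(V))) (q0 : Bil(V, R[i]^o)),
    quadric_equation q0 /\
    general_point (fun x : V =>
      [/\ s x x != 0, lker (r x x) = 0%VS
        & same_quadric (vsval (s x x)) (pullback (r x x) q0)]).
Proof.
have [e1 [e2 [e3 [x [y [z [bases zH WE]]]]]]] :=
  @normal_congruence_bases R[i] V W H dimV normal_W.
rewrite -zH in L_eq_H.
case: WE => WE.
- exact: (two_points_image congruence_s bases L_eq_H WE).
- exact: (double_point_image congruence_s bases L_eq_H WE).
Qed.
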